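(* Let $C\ge 1$, $\alpha\in(0,1)$, and let $(\mathbb{P}_n)_{n\ge 0}$ be a prefix-heavy sequence of measures on tuples of reduced words with parameters $(C,\alpha)$. If there exists a sequence $(\eta_n)_{n\ge 0}$ of positive real numbers such that $$\lim_{n\to\infty}\mathbb{P}_n\left(\mathsf{size}^2\,\alpha^{\frac{\mathsf{min}}{2}}>\eta_n\right)=0\quad\text{and}\quad \lim_{n\to\infty}\eta_n=0,$$ then a random tuple of words generically has the central tree property; in particular, generically such a tuple is a basis of the subgroup of $F(A)$ it generates. Moreover, if both of these limits converge polynomially (resp. super-polynomially, exponentially) fast, i.e. both sequences are polynomially (resp. super-polynomially, exponentially) small, then the central tree property holds polynomially (resp. super-polynomially, exponentially) generically.
   Context: $A$ is a finite non-empty alphabet, $\tilde A=A\sqcup A^{-1}$, and $F(A)$ is the free group on $A$, identified with the set $\mathcal{R}$ of all reduced words over $\tilde A$ (words with no factor $aa^{-1}$, $a\in\tilde A$), including the empty word. $\mathcal{R}_n$ is the set of reduced words of length $n$. For $u\in\mathcal{R}$, $\mathcal{P}(u)$ is the set of reduced words having $u$ as a prefix (empty if $u$ is not reduced). A sequence $(\mathbb{R}_n)_{n\ge0}$ of probability measures on $\mathcal{R}$ is prefix-heavy with parameters $(C,\alpha)$ ($C\ge1$, $0<\alpha<1$) if (1) the support of $\mathbb{R}_n$ is contained in $\mathcal{R}_n$ for every $n$, and (2) for every $n\ge0$ and $u\in\mathcal{R}$ with $\mathbb{R}_n(\mathcal{P}(u))\ne0$, and every $v\in\mathcal{R}$,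 $\mathbb{R}_n(\mathcal{P}(uv)\mid\mathcal{P}(u))\le C\alpha^{|v|}$ (where $uv$ is the concatenation). A prefix-heavy sequence of measures on tuples of reduced words with parameters $(C,\alpha)$ is a sequence $(\mathbb{P}_n)_{n\ge0}$ of probability measures on the set of all finite tuples of reduced words such that $\mathbb{P}_n(h_1,\dots,h_k)=\mathbb{T}_n(|h_1|,\dots,|h_k|)\prod_{i=1}^k\mathbb{R}_{|h_i|}(h_i)$, where $(\mathbb{T}_n)_n$ is a sequence of probability measures on the set of finite tuples (of size $k \geq 1$) of non-negative integers and $(\mathbb{R}_n)_n$ is a prefix-heavy sequence of measures on $\mathcal{R}$ with parameters $(C,\alpha)$. For a tuple $\vec h=(h_1,\dots,h_k)$: $\mathsf{size}(\vec h)=k$, $\mathsf{min}(\vec h)=\min_i|h_i|$, $\vec h^{\pm}=(h_1,h_1^{-1},\dots,h_k,h_k^{-1})$, and $\mathsf{lcp}(\vec h)$ is the length of the longest common prefix between two entries (at distinct indices) of $\vec h^\pm$. The tuple has the central tree property if $2\,\mathsf{lcp}(\vec h)<\mathsf{min}(\vec h)$. A property holds generically if the $\mathbb{P}_n$-probability of its failure tends to $0$; it holds exponentially (resp. super-polynomially, polynomially) generically if this probability is exponentially (resp. super-polynomially, polynomially) small. A function $g$ with limit $0$ is exponentially small if $g(n)=o(e^{-dn})$ for some $d>0$; super-polynomially small if $g(n)=o(n^{-d})$ for every positive integer $d$; polynomially small if $g(n)=o(n^{-d})$ for some positive integer $d$. *)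

(* Defs.v *)
From HB Require Import structures.
From mathcomp Require Import all_boot all_order all_algebra.
From mathcomp Require Import all_classical all_reals all_analysis.

Set Implicit Arguments.
Unset Strict Implicit.
Unset Printing Implicit Defensive.

Import Order.TTheory GRing.Theory Num.Theory.
Import numFieldNormedType.Exports.

Local Open Scope classical_set_scope.
Local Open Scope ring_scope.

Section FreeGroup.
Variable A : finType.

(* [inl a] is the letter a and [inr a] is its formal inverse *)
Definition letter : finType := (A + A)%type.

Definition linv (x : letter) : letter :=
  match x with inl a => inr a | inr a => inl a end.

Definition reduced (w : seq letter) : bool :=
  sorted (fun x y => y != linv x) w.

Record fgroup := FGroup { fgval :> seq letter; _ : reduced fgval }.

HB.instance Definition _ := [isSub for fgval].
HB.instance Definition _ := [Countable of fgroup by <:].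

Lemma linvK : involutive linv. Proof. by case. Qed.

Definition fcons (x : letter) (w : seq letter) : seq letter :=
  if w is y :: w' then if y == linv x then w' else x :: w else [:: x].

Definition freduce (w : seq letter) : seq letter := foldr fcons [::] w.

Lemma reduced_fcons x w : reduced w -> reduced (fcons x w).
Proof.
case: w => [//|y w] /= rw; case: ifPn => [_|yx] /=; last by rewrite yx.
exact: path_sorted rw.
Qed.

Lemma reduced_freduce w : reduced (freduce w).
Proof. by elim: w => //= x w; apply: reduced_fcons. Qed.

Lemma fconsK x w : reduced w -> fcons (linv x) (fcons x w) = w.
Proof.
case: w => [|y w] /=; first by rewrite linvK eqxx.
case: eqP => [-> | _] /=; last by rewrite linvK eqxx.
by case: w => [//|z w] /= /andP[/negPf ->].
Qed.

Lemma fconsVK x w : reduced w -> fcons x (fcons (linv x) w) = w.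
Proof. by move=> rw; rewrite -{1}(linvK x) fconsK. Qed.

Lemma freduce_id w : reduced w -> freduce w = w.
Proof.
elim: w => //= x w IH rw; rewrite IH; last exact: path_sorted rw.
by case: w rw {IH} => [//|y w] /= /andP[/negPf ->].
Qed.

Lemma reduced_foldr u w : reduced w -> reduced (foldr fcons w u).
Proof. by move=> rw; elim: u => //= x u; apply: reduced_fcons. Qed.

Lemma foldr_fcons x u w : reduced w ->
  foldr fcons w (fcons x u) = fcons x (foldr fcons w u).
Proof.
move=> rw; case: u => [//|y u] /=; case: eqP => // ->.
by rewrite fconsVK // reduced_foldr.
Qed.

Lemma foldr_freduce u w : reduced w ->
  foldr fcons w (freduce u) = foldr fcons w u.
Proof. by move=> rw; elim: u => //= x u IH; rewrite foldr_fcons // IH. Qed.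

Lemma freduce_cat u v : freduce (u ++ v) = foldr fcons (freduce v) u.
Proof. exact: foldr_cat. Qed.

Lemma reduced_inv w : reduced w -> reduced (rev (map linv w)).
Proof.
rewrite /reduced rev_sorted sorted_map; apply: sub_sorted => x y /=.
by apply: contraNneq => ->; rewrite linvK.
Qed.

Definition fg_one : fgroup := @FGroup [::] isT.
Definition fg_mul (u v : fgroup) : fgroup := FGroup (reduced_freduce (u ++ v)).
Definition fg_inv (u : fgroup) : fgroup := FGroup (reduced_inv (valP u)).
Definition fg_gen (a : A) : fgroup := @FGroup [:: inl a] isT.

Lemma fg_mulA : associative fg_mul.
Proof.
move=> u v w; apply: val_inj => /=.
rewrite freduce_cat (freduce_id (reduced_freduce _)) !freduce_cat.
by rewrite (freduce_id (valP w)) -freduce_cat foldr_freduce ?(valP w) ?foldr_cat.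
Qed.

Lemma fg_mul1 : left_id fg_one fg_mul.
Proof. by move=> u; apply: val_inj; apply: freduce_id (valP u). Qed.

Lemma fg_mulr1 : right_id fg_one fg_mul.
Proof. by move=> u; apply: val_inj; rewrite /= cats0; apply: freduce_id (valP u). Qed.

Lemma fg_invK : involutive fg_inv.
Proof.
by move=> u; apply: val_inj; rewrite /= map_rev revK -map_comp (eq_map linvK) map_id.
Qed.

Lemma fg_mulV : left_inverse fg_one fg_inv fg_mul.
Proof.
move=> [u ru]; apply: val_inj => /=.
rewrite freduce_cat (freduce_id ru).
elim: u ru => //= x u IH ru; have ru' := path_sorted ru.
rewrite rev_cons foldr_rcons; set w := fcons _ _.
suff -> : w = u by exact: IH.
by rewrite /w /= linvK eqxx.
Qed.

Lemma fg_mulrV : right_inverse fg_one fg_inv fg_mul.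
Proof. by move=> u; rewrite -{1}(fg_invK u) fg_mulV. Qed.

HB.instance Definition _ := isGroup.Build fgroup
  fg_mulA fg_mul1 fg_mulr1 fg_mulV fg_mulrV.

HB.instance Definition _ := isPointed.Build fgroup fg_one.
HB.instance Definition _ := @isMeasurable.Build default_measure_display
  fgroup (@discrete_measurable fgroup) (@discrete_measurable0 fgroup)
  (@discrete_measurableC fgroup) (@discrete_measurableU fgroup).

(* P(u) for an arbitrary word u; empty unless u is reduced *)
Definition cylinder (u : seq letter) : set fgroup :=
  [set w : fgroup | prefix u (fgval w)].

End FreeGroup.

Definition tuples (T : countType) : Type := seq T.
HB.instance Definition _ (T : countType) := Countable.on (tuples T).
HB.instance Definition _ (T : countType) := isPointed.Build (tuples T) [::].
HB.instance Definition _ (T : countType) :=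
  @isMeasurable.Build default_measure_display (tuples T)
  (@discrete_measurable (tuples T)) (@discrete_measurable0 (tuples T))
  (@discrete_measurableC (tuples T)) (@discrete_measurableU (tuples T)).

Section Subgroups.
Variable G : groupType.
Local Open Scope group_scope.

Definition is_subgroup (H : set G) : Prop :=
  [/\ H 1, forall x y, H x -> H y -> H (x * y) & forall x, H x -> H x^-1].

Definition generated_subgroup (X : set G) : set G := smallest is_subgroup X.

(* x is a basis of H: the morphism from the free group of rank k that maps
   the i-th generator to x i is an isomorphism onto H *)
Definition is_basis (k : nat) (x : 'I_k -> G) (H : set G) : Prop :=
  exists2 phi : {multiplicative fgroup 'I_k -> G},
    (forall i, phi (fg_gen i) = x i) & set_bij [set: fgroup 'I_k] H phi.

End Subgroups.

Section TuplesOfWords.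
Variable A : finType.
Implicit Types h : tuples (fgroup A).

Definition pm_tuple h : tuples (fgroup A) :=
  flatten [seq [:: w; w^-1%g] | w <- h].

Fixpoint common_prefix_length (u v : seq (letter A)) : nat :=
  match u, v with
  | a :: u', b :: v' => if a == b then (common_prefix_length u' v').+1 else 0
  | _, _ => 0
  end.

Definition lcp h : nat :=
  let s := pm_tuple h in
  (\max_(i < size s) \max_(j < size s | i != j)
     common_prefix_length (nth 1%g s i) (nth 1%g s j))%N.

(* the length of the first word only initializes the iterated minimum;
   the value is 0 on the empty tuple *)
Definition min_length h : nat :=
  \big[minn/size (head 1%g h)]_(w <- h) size w.

Definition central_tree_property h : Prop := (2 * lcp h < min_length h)%N.

Definition basis_of_generated_subgroup h : Prop :=
  is_basis (fun i : 'I_(size h) => nth 1%g h i)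
           (generated_subgroup [set w | w \in (h : seq _)]).

End TuplesOfWords.

Section Probability.
Variable R : realType.

Definition Pr d (T : measurableType d) (P : probability T R) (E : set T) : R :=
  fine (P E).

Definition cond_Pr d (T : measurableType d) (P : probability T R)
  (E F : set T) : R := Pr P (E `&` F) / Pr P F.

Definition prefix_heavy (A : finType) (C alpha : R)
    (Rn : nat -> probability (fgroup A) R) : Prop :=
  (forall n (w : fgroup A), Pr (Rn n) [set w] != 0 -> size w = n) /\
  (forall n (u v : fgroup A), Pr (Rn n) (cylinder u) != 0 ->
     cond_Pr (Rn n) (cylinder (fgval u ++ fgval v)) (cylinder u)
       <= C * alpha ^+ size v).

(* [tuples] contains the empty tuple, to which T must give mass 0 *)
Definition prefix_heavy_tuples (A : finType) (C alpha : R)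
    (P : nat -> probability (tuples (fgroup A)) R) : Prop :=
  exists (T : nat -> probability (tuples nat) R)
         (Rn : nat -> probability (fgroup A) R),
    [/\ forall n, Pr (T n) [set [::]] = 0,
        prefix_heavy C alpha Rn &
        forall n (h : tuples (fgroup A)),
          Pr (P n) [set h] =
            Pr (T n) [set [seq size (fgval w) | w <- h]]
            * \prod_(w <- h) Pr (Rn (size w)) [set w]].

Definition size_min_tail (A : finType) (alpha : R)
    (P : nat -> probability (tuples (fgroup A)) R) (eta : nat -> R)
    (n : nat) : R :=
  Pr (P n) [set h : tuples (fgroup A) |
    eta n < (size h)%:R ^+ 2 * alpha `^ ((min_length h)%:R / 2)].

Definition exponentially_small (g : nat -> R) : Prop :=
  exists2 d : R, 0 < d & g =o_\oo (fun n => expR (- d * n%:R)).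

Definition super_polynomially_small (g : nat -> R) : Prop :=
  forall d : nat, (0 < d)%N -> g =o_\oo (fun n => (n%:R : R) ^- d).

Definition polynomially_small (g : nat -> R) : Prop :=
  exists2 d : nat, (0 < d)%N & g =o_\oo (fun n => (n%:R : R) ^- d).

Section Genericity.
Variables (d : measure_display) (T : measurableType d).
Variables (P : nat -> probability T R) (X : T -> Prop).

Definition failure_Pr (n : nat) : R := Pr (P n) [set x | ~ X x].

Definition generically : Prop := failure_Pr n @[n --> \oo] --> (0 : R).

Definition exponentially_generically : Prop := exponentially_small failure_Pr.

Definition super_polynomially_generically : Prop :=
  super_polynomially_small failure_Pr.

Definition polynomially_generically : Prop := polynomially_small failure_Pr.

End Genericity.

End Probability.

(* Main.v *)
(* Condition on the lengths of the words, with minimum m, and put s = floor(m/2).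
   If the central tree property fails, two of the 2k words of h^+- share a prefix
   of length s.  Fix all the words but one of those involved: the last word must
   then have a prescribed prefix of length s, or a suffix of length s determined
   by the letters preceding it (this covers the overlap of h_i with h_i^-1, since
   2s <= |h_i|).  Prefix-heaviness bounds either probability by C alpha^s, so the
   union bound over pairs gives a conditional failure probability of at most
   4 k^2 C alpha^s <= (4 C / alpha) k^2 alpha^(m/2), hence
     P_n(failure) <= P_n(size^2 alpha^(min/2) > eta_n) + (4 C / alpha) eta_n.
   The central tree property implies freeness because in a reduced product of the
   words h_i^+- each cancellation is shorter than half of either factor. *)

Require Import Defs.
From HB Require Import structures.
From mathcomp Require Import all_boot all_order all_algebra.
From mathcomp Require Import all_classical all_reals all_analysis.
From mathcomp Require Import zify ring.
Import Order.TTheory GRing.Theory Num.Theory.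
Import numFieldNormedType.Exports.
Local Open Scope classical_set_scope.
Local Open Scope ring_scope.

Set Implicit Arguments.
Unset Strict Implicit.
Unset Printing Implicit Defensive.

(** * Real-valued probabilities when every set is measurable *)

Section Measure.
Context (R : realType) (d : measure_display) (T : measurableType d).
Hypothesis mT : forall E : set T, measurable E.
Variable mu : probability T R.
Implicit Types E F : set T.

Lemma Pr_ge0 E : 0 <= Pr mu E.
Proof. exact/fine_ge0/measure_ge0. Qed.

Lemma Pr_EFin E : (Pr mu E)%:E = mu E.
Proof. by rewrite /Pr fineK // fin_num_measure. Qed.

Lemma le_Pr E F : E `<=` F -> Pr mu E <= Pr mu F.
Proof. by move=> EF; rewrite -lee_fin !Pr_EFin le_measure ?inE. Qed.

Lemma Pr0 : Pr mu set0 = 0.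
Proof. by rewrite /Pr measure0. Qed.

Lemma PrT : Pr mu setT = 1.
Proof. by rewrite /Pr probability_setT. Qed.

Lemma Pr_le1 E : Pr mu E <= 1.
Proof. by rewrite -PrT le_Pr. Qed.

Lemma Pr_setU E F : E `&` F = set0 -> Pr mu (E `|` F) = Pr mu E + Pr mu F.
Proof. by move=> EF; apply: EFin_inj; rewrite EFinD !Pr_EFin measureU. Qed.

Lemma Pr_setU_le E F : Pr mu (E `|` F) <= Pr mu E + Pr mu F.
Proof. by rewrite -lee_fin EFinD !Pr_EFin measureU2. Qed.

Lemma Pr_seq (s : seq T) E : uniq s ->
  Pr mu (E `&` [set` s]) = \sum_(x <- s | `[< E x >]) Pr mu [set x].
Proof.
elim: s => [|x s IH] /=.
  by move=> _; rewrite big_nil -[RHS]Pr0; congr (Pr mu _); apply/seteqP; split=> x /= [].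
move=> /andP[xs us]; rewrite big_cons -IH //.
case: ifPn => [/asboolP|/asboolPn] Ex.
  rewrite -Pr_setU.
    congr (Pr mu _); apply/seteqP; split=> y /=.
      by rewrite inE => -[Ey /orP[/eqP ->|ys]]; [left|right].
    by rewrite inE => -[->|[Ey ->]]; rewrite ?eqxx ?orbT.
  by apply/seteqP; split=> y //= [-> []]; rewrite (negPf xs).
congr (Pr mu _); apply/seteqP; split=> y /=; rewrite inE => -[Ey].
  by move=> /orP[/eqP yx|//]; rewrite yx in Ey.
by move=> ->; rewrite orbT.
Qed.

End Measure.

(** * Disintegration along a countable-valued map *)

Section Fibres.
Context (R : realType) (d d' : measure_display).
Context (T : measurableType d) (T' : measurableType d') (S : countType).
Hypotheses (mT : forall E : set T, measurable E).
Hypotheses (mT' : forall E : set T', measurable E).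
Variables (mu : probability T R) (nu : probability T' R).

(** Countable additivity on both sides: the fibres of [f] cut [E] into pieces, and the fibres of [g]
    have total mass 1. This is the law of total probability without any division, so null fibres
    need no separate treatment. *)
Lemma Pr_le_fibres (f : T -> S) (g : T' -> S) (E : set T) (c : R) :
  0 <= c ->
  (forall s, Pr mu (E `&` f @^-1` [set s]) <= c * Pr nu (g @^-1` [set s])) ->
  Pr mu E <= c.
Proof.
move=> c0 le_c.
(* The fibres are indexed by the codes [pickle s], which turns the sum over [S] into a series over
   [nat]. *)
have cover U (h : U -> S) (F : set U) :
    F = \bigcup_i (F `&` [set x | pickle (h x) = i]).
  by apply/seteqP; split=> [x Fx|x [i _ []//]]; exists (pickle (h x)).
have triv U (h : U -> S) (F : set U) :
    trivIset setT (fun i => F `&` [set x | pickle (h x) = i]).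
  by apply/trivIsetP => i j _ _ ij; apply/seteqP; split=> x //= [[_ hi] [_ hj]];
     rewrite -hi -hj eqxx in ij.
rewrite -lee_fin Pr_EFin // (cover _ f E) measure_bigcup //.
rewrite -[c%:E]mule1 -(probability_setT nu) (cover _ g setT) measure_bigcup //.
rewrite -nneseriesZl //; apply: lee_nneseries => // i _.
(* An index that codes no element of [S] contributes an empty piece. *)
have [[s <-]|nos] := pselect (exists s : S, pickle s = i).
  have inj := pcan_inj (@pickleK S).
  have -> : E `&` [set x | pickle (f x) = pickle s] = E `&` f @^-1` [set s].
    by apply/seteqP; split=> x /= [Ex]; [move/inj|move=> ->].
  have -> : setT `&` [set x | pickle (g x) = pickle s] = g @^-1` [set s].
    by apply/seteqP; split=> x /=; [case=> _ /inj|move=> ->].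
  by have := le_c s; rewrite -lee_fin EFinM !Pr_EFin.
rewrite (_ : E `&` _ = set0) ?measure0 ?mule_ge0 //.
by apply/seteqP; split=> x //= [_ fx]; apply: nos; exists (f x).
Qed.

End Fibres.

(** * Finite enumerations of words and tuples with prescribed lengths *)

Section Words.
Variable A : finType.
Implicit Types (u v : seq (letter A)) (w : fgroup A) (h : tuples (fgroup A)).

Lemma reduced_cat u v : reduced (u ++ v) -> reduced u && reduced v.
Proof. by move/cat_sorted2 => [] *; apply/andP. Qed.

Lemma cylinder_nonreduced u : ~~ reduced u -> cylinder u = set0.
Proof.
move=> ru; apply/seteqP; split=> w //= /prefixP[t wt].
by case/negP: ru; have := valP w; rewrite /= wt => /reduced_cat/andP[].
Qed.

Definition words (l : nat) : seq (fgroup A) :=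
  pmap insub [seq val t | t <- enum {: l.-tuple (letter A)}].

Lemma mem_words l w : (w \in words l) = (size w == l).
Proof.
rewrite mem_pmap_sub; apply/mapP/eqP => [[t _ ->]|wl]; first exact: size_tuple.
by subst l; exists (in_tuple w); rewrite ?mem_enum.
Qed.

Lemma uniq_words l : uniq (words l).
Proof. by rewrite pmap_sub_uniq // map_inj_uniq ?enum_uniq //; apply: val_inj. Qed.

Definition word_tuples (ls : seq nat) : seq (tuples (fgroup A)) :=
  foldr (fun l hs => [seq w :: h | w <- words l, h <- hs]) [:: [::]] ls.

Lemma mem_word_tuples ls h :
  (h \in word_tuples ls) = ([seq size (fgval w) | w <- h] == ls).
Proof.
elim: ls h => [|l ls IH] h /=; first by rewrite inE; case: h.
apply/allpairsP/eqP => [[[w h'] /= [wl h'ls ->]] /=|].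
  by rewrite mem_words in wl; rewrite IH in h'ls; rewrite (eqP wl) (eqP h'ls).
case: h => //= w h [wl hls]; exists (w, h); split=> //=.
  by rewrite mem_words wl.
by rewrite IH hls.
Qed.

Lemma uniq_word_tuples ls : uniq (word_tuples ls).
Proof.
elim: ls => //= l ls IH; apply: allpairs_uniq => //; first exact: uniq_words.
by move=> [w h] [w' h'] /= _ _ [-> ->].
Qed.

End Words.

(** * Product weights on tuples with prescribed lengths *)

Section Independence.
Context (R : realType) (A : finType) (Rn : nat -> probability (fgroup A) R).
Implicit Types (h : tuples (fgroup A)) (E : tuples (fgroup A) -> Prop).

Definition weight h : R := \prod_(w <- h) Pr (Rn (size w)) [set w].

Lemma weight_ge0 h : 0 <= weight h.
Proof. by apply: prodr_ge0 => w _; apply: Pr_ge0. Qed.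

Lemma sum_words_le l (E : fgroup A -> Prop) :
  \sum_(w <- words A l | `[< E w >]) Pr (Rn (size w)) [set w] <=
  Pr (Rn l) [set w | E w].
Proof.
rewrite big_seq_cond (eq_bigr (fun w => Pr (Rn l) [set w])); last first.
  by move=> w; rewrite mem_words => /andP[/eqP ->].
by rewrite -big_seq_cond -(Pr_seq _ _ E) ?uniq_words // le_Pr // => w [].
Qed.

Lemma sum_words_le1 l : \sum_(w <- words A l) Pr (Rn (size w)) [set w] <= 1.
Proof.
apply: (@le_trans _ _ (Pr (Rn l) [set w | True])); last exact: Pr_le1.
apply: le_trans (sum_words_le l (fun=> True)); rewrite le_eqVlt; apply/orP; left.
by apply/eqP/eq_bigl => w; apply/esym/asboolP.
Qed.

Lemma sum_word_tuples_le1 ls : \sum_(h <- word_tuples A ls) weight h <= 1.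
Proof.
elim: ls => [|l ls IH] /=; first by rewrite big_seq1 /weight big_nil.
rewrite big_allpairs_dep /=.
apply: le_trans (sum_words_le1 l); apply: ler_sum => w _.
under eq_bigr do rewrite /weight big_cons.
by rewrite -mulr_sumr ler_piMr // Pr_ge0.
Qed.

(** Fubini: sum first over the [j]-th word with the others frozen, then over the others, whose total
    weight is at most 1. The use of [set_nth] expresses that entry [j] is free while the rest of [h]
    is arbitrary but fixed. *)
Lemma sum_word_tuples_le ls j E (c : R) : (j < size ls)%N ->
  (forall h, Pr (Rn (nth 0%N ls j)) [set w | E (set_nth 1%g h j w)] <= c) ->
  \sum_(h <- word_tuples A ls | `[< E h >]) weight h <= c.
Proof.
move=> jls le_c; have c0 : 0 <= c := le_trans (Pr_ge0 _ _) (le_c [::]).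
elim: ls j E jls le_c => // l ls IH [|j] E /= jls le_c.
  (* For [j = 0] the free word is the head, so its sum is moved inside. *)
  rewrite big_mkcond big_allpairs_dep /= exchange_big /=.
  apply: le_trans (_ : \sum_(h <- word_tuples A ls) c * weight h <= c); last first.
    by rewrite -mulr_sumr ler_piMr // sum_word_tuples_le1.
  apply: ler_sum => h _; rewrite -big_mkcond /=.
  under eq_bigr do rewrite /weight big_cons -/(weight h).
  rewrite -mulr_suml ler_wpM2r ?weight_ge0 //.
  exact: le_trans (sum_words_le l (fun w => E (w :: h))) (le_c (1%g :: h)).
rewrite big_mkcond big_allpairs_dep /=.
apply: le_trans (_ : \sum_(w <- words A l) c * Pr (Rn (size w)) [set w] <= c); last first.
  by rewrite -mulr_sumr ler_piMr // sum_words_le1.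
apply: ler_sum => w _; rewrite -big_mkcond /=.
under eq_bigr do rewrite /weight big_cons.
rewrite -mulr_sumr mulrC ler_wpM2r ?Pr_ge0 //.
by apply: (IH j (fun h => E (w :: h))) => // h; apply: (le_c (w :: h)).
Qed.

End Independence.

(** * Prescribed prefixes and suffixes under prefix-heavy measures *)

Section PrefixHeavy.
Context (R : realType) (A : finType) (C alpha : R).
Hypotheses (hC : 1 <= C) (alpha_gt0 : 0 < alpha).
Variable Rn : nat -> probability (fgroup A) R.
Hypothesis hRn : prefix_heavy C alpha Rn.
Implicit Types (u v : seq (letter A)) (w : fgroup A).

Let bound_ge0 k : 0 <= C * alpha ^+ k.
Proof. by rewrite mulr_ge0 ?exprn_ge0 ?ltW // (lt_le_trans ltr01). Qed.

(** The definition only makes single words of the wrong length null; countable additivity, through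
    the fibres of the identity with constant 0, extends this to the whole set. *)
Lemma prefix_heavy_support l : Pr (Rn l) [set w | size w != l] = 0.
Proof.
apply/eqP; rewrite eq_le Pr_ge0 andbT.
apply: (@Pr_le_fibres _ _ _ _ _ (fgroup A) _ _ _ (Rn l) id id) => // w.
rewrite mul0r; have [w0|/(proj1 hRn) wl] := eqVneq (Pr (Rn l) [set w]) 0.
  by rewrite -w0 le_Pr // => _ [].
by rewrite -(Pr0 (Rn l)) le_Pr // => x [/= + xw]; rewrite xw wl eqxx.
Qed.

(* No reducedness hypothesis: the left-hand side vanishes when [u ++ v] is not reduced. *)
Lemma prefix_heavy_cylinder l u v :
  Pr (Rn l) (cylinder (u ++ v)) <= C * alpha ^+ size v * Pr (Rn l) (cylinder u).
Proof.
have [|ruv] := boolP (reduced (u ++ v)); last first.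
  by rewrite cylinder_nonreduced // Pr0 mulr_ge0 // Pr_ge0.
move=> /reduced_cat/andP[ru rv].
have sub : cylinder (u ++ v) `<=` cylinder u.
  by move=> w /= /(prefix_trans (prefix_prefix _ _)).
(* The conditional bound says nothing at a null cylinder, but there both sides vanish. *)
have [u0|u0] := eqVneq (Pr (Rn l) (cylinder u)) 0.
  by rewrite u0 mulr0 -u0 le_Pr.
have := hRn.2 l (FGroup ru) (FGroup rv) u0.
rewrite /cond_Pr /= ler_pdivrMr ?lt0r ?u0 ?Pr_ge0 //.
by rewrite setIidl.
Qed.

Lemma prefix_heavy_prefix l u :
  Pr (Rn l) (cylinder u) <= C * alpha ^+ size u.
Proof.
have := prefix_heavy_cylinder l [::] u; rewrite cat0s => /le_trans; apply.
by rewrite ler_piMr // Pr_le1.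
Qed.

(* Conditioning on the first [l - s] letters determines the last [s] letters. *)
Lemma prefix_heavy_suffix l s (f : seq (letter A) -> seq (letter A)) :
  (forall v, size v = (l - s)%N -> size (f v) = s) ->
  Pr (Rn l) [set w : fgroup A | drop (l - s) w = f (take (l - s) w)] <=
  C * alpha ^+ s.
Proof.
move=> sz_f; pose hd (w : fgroup A) := take (l - s) w.
apply: (@Pr_le_fibres _ _ _ _ _ (seq (letter A)) _ _ _ (Rn l) hd hd) => // v.
(* A head of any other length comes only from words of length different from [l], which form a null
   set. *)
have [vl|vl] := eqVneq (size v) (l - s)%N; last first.
  apply: (@le_trans _ _ 0); last by rewrite mulr_ge0 // Pr_ge0.
  rewrite -(prefix_heavy_support l) le_Pr // => w [_ /= hdw].
  apply: contra vl => /eqP wl; apply/eqP.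
  by rewrite -hdw size_take wl; case: ltnP => //; lia.
apply: (@le_trans _ _ (Pr (Rn l) (cylinder (v ++ f v)))).
  apply: le_Pr => // w [/= fw hdw]; apply/prefixP; exists [::].
  by rewrite cats0 -hdw -fw cat_take_drop.
apply: le_trans (prefix_heavy_cylinder l v (f v)) _.
rewrite sz_f // ler_wpM2l // le_Pr // => w /=.
by rewrite /cylinder /= prefixE vl => /eqP.
Qed.

End PrefixHeavy.

(** * Combinatorics of common prefixes in the symmetrized tuple *)

Section Coincidences.
Variable A : finType.
Implicit Types (u v : seq (letter A)) (w : fgroup A) (h : tuples (fgroup A)).

Definition linv_rev u : seq (letter A) := rev (map (@linv A) u).

Lemma size_linv_rev u : size (linv_rev u) = size u.
Proof. by rewrite size_rev size_map. Qed.

(** Inversion exchanges prefixes and suffixes; this turns a prefix coincidence involving an inverse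
    into a condition on the last letters of the word itself. *)
Lemma drop_take_linv_rev s u :
  drop (size u - s) u = linv_rev (take s (linv_rev u)).
Proof.
rewrite /linv_rev take_rev size_map map_rev revK -map_drop -map_comp.
by rewrite (eq_map (@linvK A)) map_id.
Qed.

Lemma common_prefix_lengthC u v :
  common_prefix_length u v = common_prefix_length v u.
Proof. by elim: u v => [|a u IH] [|b v] //=; rewrite eq_sym IH. Qed.

Lemma leq_common_prefix_length s u v : (s <= common_prefix_length u v)%N =
  [&& s <= size u, s <= size v & take s u == take s v]%N.
Proof.
elim: u v s => [|a u IH] [|b v] [|s] //=; first by rewrite andbF.
by rewrite eqseq_cons; case: eqP => _; rewrite ?andbF // !ltnS IH.
Qed.

Lemma size_pm_tuple h : size (pm_tuple h) = (2 * size h)%N.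
Proof. by elim: h => //= w h IH; rewrite -/(pm_tuple h) IH; lia. Qed.

Lemma nth_pm_tuple h i : nth 1%g (pm_tuple h) i =
  (if odd i then (nth 1 h i./2)^-1 else nth 1 h i./2)%g.
Proof.
elim: h i => [|w h IH] i; first by rewrite !nth_nil invg1 if_same.
by case: i => [|[|i]] //=; rewrite -/(pm_tuple h) IH negbK.
Qed.

(** The maximum is attained at some pair of positions. Nonemptiness serves the case [s = 0], where
    positions 0 and 1 (the first word and its inverse) are taken. *)
Lemma leq_lcp h s : (0 < size h)%N -> (s <= lcp h)%N ->
  exists p : 'I_(2 * size h) * 'I_(2 * size h), p.1 != p.2 /\
    (s <= common_prefix_length (nth 1%g (pm_tuple h) p.1)
                               (nth 1%g (pm_tuple h) p.2))%N.
Proof.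
rewrite -size_pm_tuple /lcp => h0; case: s => [_|s].
  have h1 : (1 < size (pm_tuple h))%N by rewrite size_pm_tuple; lia.
  by exists (Ordinal (ltnW h1), Ordinal h1).
move=> ltsl; apply: contrapT => nex; move: ltsl; apply/negP; rewrite -leqNgt.
apply/bigmax_leqP => i _; apply/bigmax_leqP => j ij; rewrite leqNgt.
by apply/negP => lt_s; apply: nex; exists (i, j).
Qed.

Lemma lcp_ge h (i j : nat) : (i < 2 * size h)%N -> (j < 2 * size h)%N -> i != j ->
  (common_prefix_length (nth 1%g (pm_tuple h) i) (nth 1%g (pm_tuple h) j)
   <= lcp h)%N.
Proof.
rewrite -size_pm_tuple => ih jh ij; rewrite /lcp.
apply: leq_trans (leq_bigmax (Ordinal ih)).
exact: (leq_bigmax_cond (P := fun j : 'I_ _ => Ordinal ih != j)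
  (F := fun j => common_prefix_length (nth 1%g (pm_tuple h) i) (nth 1%g (pm_tuple h) j))
  (Ordinal jh)).
Qed.

(** Read off the lengths alone, the minimum is constant on the fibres of the length map. *)
Definition min_seq (ls : seq nat) : nat := \big[minn/head 0%N ls]_(l <- ls) l.

Lemma min_lengthE h : min_length h = min_seq [seq size (fgval w) | w <- h].
Proof. by rewrite /min_length /min_seq big_map; case: h. Qed.

Lemma min_seq_le ls l : l \in ls -> (min_seq ls <= l)%N.
Proof.
(* The initial value is generalised, since the head changes along the induction. *)
rewrite /min_seq; move: (head _ _) => x.
elim: ls => //= k ls IH; rewrite inE big_cons geq_min.
by case/orP => [/eqP ->|/IH ->]; rewrite ?leqnn ?orbT.
Qed.

End Coincidences.

(** * Probability of a coincidence at a given pair of positions *)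

Section PairBound.
Context (R : realType) (A : finType) (C alpha : R).
Hypotheses (hC : 1 <= C) (alpha_gt0 : 0 < alpha).
Variable Rn : nat -> probability (fgroup A) R.
Hypothesis hRn : prefix_heavy C alpha Rn.
Implicit Types (u v : seq (letter A)) (w : fgroup A) (h : tuples (fgroup A)).

Lemma Pr_le_support l (E F : set (fgroup A)) :
  (forall w, E w -> size w = l -> F w) -> Pr (Rn l) E <= Pr (Rn l) F.
Proof.
move=> EF; rewrite -[leRHS]add0r -(prefix_heavy_support hRn l).
apply: le_trans (Pr_setU_le _ _ _ _) => //; apply: le_Pr => // w Ew.
by have [/(EF _ Ew)|] := eqVneq (size w) l; [right|left].
Qed.

Lemma Pr_common_prefix l s u : (s <= l)%N ->
  Pr (Rn l) [set w | s <= common_prefix_length u (fgval w)]%N <= C * alpha ^+ s.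
Proof.
move=> sl; have [su|us] := leqP s (size u); last first.
  rewrite (_ : [set w | _] = set0); last first.
    by apply/seteqP; split=> w //=; rewrite leq_common_prefix_length leqNgt us.
  by rewrite Pr0 mulr_ge0 ?exprn_ge0 ?ltW // (lt_le_trans ltr01).
rewrite -[X in alpha ^+ X](size_takel su).
apply: le_trans (prefix_heavy_prefix hC alpha_gt0 hRn l (take s u)).
apply: le_Pr => // w /=; rewrite leq_common_prefix_length => /and3P[_ _ /eqP uw].
by rewrite /cylinder /= prefixE size_takel // uw.
Qed.

Lemma Pr_common_suffix l s u : (s <= l)%N ->
  Pr (Rn l) [set w | s <= common_prefix_length u (linv_rev (fgval w))]%N
  <= C * alpha ^+ s.
Proof.
move=> sl; have [su|us] := leqP s (size u); last first.
  rewrite (_ : [set w | _] = set0); last first.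
    by apply/seteqP; split=> w //=; rewrite leq_common_prefix_length leqNgt us.
  by rewrite Pr0 mulr_ge0 ?exprn_ge0 ?ltW // (lt_le_trans ltr01).
apply: le_trans (prefix_heavy_suffix hC alpha_gt0 hRn (l := l) (s := s)
  (f := fun=> linv_rev (take s u)) _); last first.
  by move=> _ _; rewrite size_linv_rev size_takel.
apply: Pr_le_support => w /=.
rewrite leq_common_prefix_length => /and3P[_ _ /eqP uw] <-.
by rewrite drop_take_linv_rev uw.
Qed.

(** The condition [2 * s <= l] places the first [s] letters among the first [l - s], so the last [s]
    letters are a function of the letters before them. *)
Lemma Pr_self_overlap l s : (2 * s <= l)%N ->
  Pr (Rn l) [set w | s <= common_prefix_length (fgval w) (linv_rev (fgval w))]%N
  <= C * alpha ^+ s.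
Proof.
move=> sl; apply: le_trans (prefix_heavy_suffix hC alpha_gt0 hRn (l := l) (s := s)
  (f := fun v => linv_rev (take s v)) _); last first.
  by move=> v vl; rewrite size_linv_rev size_takel // vl; lia.
apply: Pr_le_support => w /=.
rewrite leq_common_prefix_length => /and3P[_ _ /eqP ww] wl.
by rewrite take_takel; [rewrite -{1}wl drop_take_linv_rev -ww|lia].
Qed.

(** Word [j./2] is the one left random. If position [i] belongs to another word, the target is
    frozen and the prefix or suffix bound applies, according to the parity of [j]; otherwise a word
    meets its own inverse. *)
Lemma sum_coincidence_le ls (i j s : nat) :
  (i < 2 * size ls)%N -> (j < 2 * size ls)%N -> i != j ->
  (forall l, l \in ls -> (2 * s <= l)%N) ->
  \sum_(h <- word_tuples A ls |
    `[< (s <= common_prefix_length (nth 1%g (pm_tuple h) i)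
                                   (nth 1%g (pm_tuple h) j))%N >])
    weight Rn h <= C * alpha ^+ s.
Proof.
move=> ils jls ij sls; have jls2 : (j./2 < size ls)%N by lia.
apply: (sum_word_tuples_le jls2) => h.
have sl := sls _ (mem_nth 0%N jls2); set l := nth 0%N ls j./2 in sl *.
have sl1 : (s <= l)%N by lia.
rewrite (_ : [set w | _] = [set w | s <= common_prefix_length
  (nth 1%g (pm_tuple (set_nth 1%g h j./2 w)) i)
  (if odd j then linv_rev (fgval w) else fgval w)]%N); last first.
  apply/seteqP; split=> w /=; rewrite (nth_pm_tuple _ j) nth_set_nth /= eqxx;
  by case: ifP.
have [ij2|ij2] := eqVneq i./2 j./2; last first.
  rewrite (_ : [set w | _] = [set w | s <= common_prefix_length
    (nth 1%g (pm_tuple h) i)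
    (if odd j then linv_rev (fgval w) else fgval w)]%N); last first.
    by apply/seteqP; split=> w /=; rewrite !(nth_pm_tuple _ i) nth_set_nth /= (negPf ij2).
  by case: (odd j); [apply: Pr_common_suffix|apply: Pr_common_prefix].
rewrite (_ : [set w | _] = [set w | s <= common_prefix_length
  (fgval w) (linv_rev (fgval w))]%N); first exact: Pr_self_overlap.
(* Distinct positions with equal halves have opposite parities, hence carry a word and its
   inverse. *)
have odd_ij : odd i = ~~ odd j.
  have := odd_double_half i; have := odd_double_half j; rewrite ij2.
  by case: (odd i); case: (odd j) => //= ? ?; lia.
apply/seteqP; split=> w /=; rewrite (nth_pm_tuple _ i) nth_set_nth /= ij2 eqxx odd_ij;
by case: (odd j) => //=; rewrite common_prefix_lengthC.
Qed.

End PairBound.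

(** * Union bound and the explicit failure estimate *)

Section FailureBound.
Context (R : realType) (A : finType) (C alpha : R).
Hypotheses (hC : 1 <= C) (alpha_gt0 : 0 < alpha) (alpha_lt1 : alpha < 1).
Variable Rn : nat -> probability (fgroup A) R.
Hypothesis hRn : prefix_heavy C alpha Rn.
Implicit Types (h : tuples (fgroup A)) (ls : seq nat).

(** Union bound over at most [(2k)^2] ordered pairs of positions. With [s] the floor of half the
    minimum, failure forces [s <= lcp h], and [2 * s] is at most every length, as the self-overlap
    case requires. *)
Lemma sum_failure_le ls : (0 < size ls)%N ->
  \sum_(h <- word_tuples A ls | `[< ~ central_tree_property h >]) weight Rn h <=
  ((2 * size ls) ^ 2)%:R * (C * alpha ^+ (min_seq ls)./2).
Proof.
move=> ls0; pose s := (min_seq ls)./2; pose I := 'I_(2 * size ls).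
pose E (p : I * I) h := (s <= common_prefix_length (nth 1%g (pm_tuple h) p.1)
                                                   (nth 1%g (pm_tuple h) p.2))%N.
apply: le_trans (_ : \sum_(p : I * I | p.1 != p.2)
    \sum_(h <- word_tuples A ls | `[< E p h >]) weight Rn h <= _).
  under [leRHS]eq_bigr do rewrite big_mkcond.
  rewrite exchange_big /= big_mkcond big_seq [leRHS]big_seq.
  apply: ler_sum => h; rewrite mem_word_tuples => /eqP hls.
  have ge0 p : 0 <= (if `[< E p h >] then weight Rn h else 0).
    by case: ifP => _ //; apply: weight_ge0.
  case: ifP => [/asboolP fail|_]; last by apply: sumr_ge0.
  have hs : size h = size ls by rewrite -hls size_map.
  have [||[i j] /= [ij Eij]] := @leq_lcp A h s; first by rewrite hs.
    move/negP: fail; rewrite -leqNgt min_lengthE hls /s; lia.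
  rewrite hs in i j ij Eij; rewrite (bigD1 (i, j)) //= asboolT //.
  by rewrite lerDl sumr_ge0.
apply: le_trans (_ : \sum_(p : I * I | p.1 != p.2) C * alpha ^+ s <= _).
  apply: ler_sum => -[i j] /= ij; apply: sum_coincidence_le => // l lls.
  by have := min_seq_le lls; rewrite /s; lia.
apply: le_trans (_ : \sum_(p : I * I) C * alpha ^+ s <= _).
  rewrite big_mkcond; apply: ler_sum => p _; case: ifP => // _.
  by rewrite mulr_ge0 ?exprn_ge0 ?ltW // (lt_le_trans ltr01).
by rewrite sumr_const card_prod card_ord mulr_natl mulnn.
Qed.

(** Since [m / 2 <= m./2 + 1], rounding down costs at most one factor [alpha^-1]; this is where the
    division by [alpha] in the final constant comes from. *)
Lemma expr_half_le_powR m : alpha ^+ m./2 <= alpha^-1 * alpha `^ (m%:R / 2).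
Proof.
rewrite ler_pdivlMl // -exprS -powR_mulrn ?(ltW alpha_gt0) //.
apply: ger_powR; first by rewrite alpha_gt0 (ltW alpha_lt1).
rewrite ler_pdivrMr // -natrM ler_nat; lia.
Qed.

Variables (T : nat -> probability (tuples nat) R).
Variables (P : nat -> probability (tuples (fgroup A)) R).
Hypothesis T0 : forall n, Pr (T n) [set [::]] = 0.
Hypothesis hP : forall n h, Pr (P n) [set h] =
  Pr (T n) [set [seq size (fgval w) | w <- h]] * weight Rn h.

Lemma failure_Pr_le (eta : nat -> R) n : 0 <= eta n ->
  failure_Pr P (@central_tree_property A) n <=
  size_min_tail alpha P eta n + 4 * C / alpha * eta n.
Proof.
move=> eta0; rewrite /failure_Pr /size_min_tail.
set tail := [set h | _ < _]; set fail := [set h | ~ _].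
apply: (@le_trans _ _ (Pr (P n) (tail `|` (fail `&` ~` tail)))).
  apply: le_Pr => // h fh; have [|] := pselect (tail h); [by left|by right].
apply: le_trans (Pr_setU_le _ _ _ _) _ => //; rewrite lerD2l.
have C0 : 0 < C := lt_le_trans ltr01 hC.
pose sizes h := [seq size (fgval w) | w <- h].
apply: (@Pr_le_fibres _ _ _ _ _ (tuples nat) _ _ _ (T n) sizes id) => //.
  by rewrite !mulr_ge0 // ?ltW // invr_gt0.
move=> ls /=; rewrite (_ : id @^-1` [set ls] = [set ls]) //.
(* Size and minimum depend only on [ls], so one element [h0] of the fibre transfers the bound by
   [eta n] to [ls]. *)
have [->|/set0P[h0 [[_ /negP tail0] hls]]] :=
    eqVneq (fail `&` ~` tail `&` sizes @^-1` [set ls]) set0.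
  by rewrite Pr0 !mulr_ge0 // ?Pr_ge0 // ?ltW // invr_gt0.
have min0 : min_length h0 = min_seq ls by rewrite min_lengthE -hls.
have size0 : size h0 = size ls by rewrite -hls size_map.
rewrite -leNgt size0 min0 in tail0.
(* The empty tuple fails the central tree property ([0 < 0]); it is null because [T n] gives it mass
   0. *)
have [lsE|ls0] := posnP (size ls).
  rewrite (size0nil lsE) T0 mulr0 in hls *.
  have -> : sizes @^-1` [set [::]] = [set [::]].
    by apply/seteqP; split=> -[].
  have := hP n [::]; rewrite T0 mul0r => <-.
  by apply: le_Pr.
apply: (@le_trans _ _ (\sum_(h <- word_tuples A ls | `[< fail h >]) Pr (P n) [set h])).
  rewrite -Pr_seq ?uniq_word_tuples //; apply: le_Pr => // h [[fh _] /= hh].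
  by split=> //=; rewrite mem_word_tuples; apply/eqP.
rewrite big_seq_cond (eq_bigr (fun h => Pr (T n) [set ls] * weight Rn h)); last first.
  by move=> h; rewrite mem_word_tuples hP => /andP[/eqP ->].
rewrite -big_seq_cond -mulr_sumr mulrC ler_wpM2r ?Pr_ge0 //.
apply: le_trans (sum_failure_le ls0) _.
set k := (size ls)%:R in tail0 *; set p := _ `^ _ in tail0 *.
rewrite [leLHS](_ : _ = 4 * C * k ^+ 2 * alpha ^+ (min_seq ls)./2); last first.
  by rewrite natrX natrM -/k; ring.
apply: (@le_trans _ _ (4 * C * k ^+ 2 * (alpha^-1 * p))).
  apply: ler_wpM2l; last exact: expr_half_le_powR.
  by rewrite !mulr_ge0 ?exprn_ge0 ?(ltW C0) ?ler0n.
rewrite [leLHS](_ : _ = 4 * C / alpha * (k ^+ 2 * p)); last by ring.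
by rewrite ler_wpM2l // !mulr_ge0 // ?ltW // invr_gt0.
Qed.

End FailureBound.

(** * Stability of the decay rates *)

Section Smallness.
Context (R : realType).
Implicit Types f g e : nat -> R.

Lemma littleo_le_lincomb f g1 g2 e (K : R) :
  (forall n, 0 <= f n <= g1 n + K * g2 n) ->
  g1 =o_\oo e -> g2 =o_\oo e -> f =o_\oo e.
Proof.
move=> f_le /eqoP g1e /eqoP g2e; apply/eqoP => eps eps0.
(* Adding 1 keeps the divisor positive even when [K = 0]. *)
have K0 : 0 < `|K| + 1 by rewrite ltr_wpDl.
have e1 : 0 < eps / 2 by rewrite divr_gt0.
have e2 : 0 < eps / 2 / (`|K| + 1) by rewrite divr_gt0.
near=> n.
have /andP[f0 fle] := f_le n; rewrite ger0_norm //.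
have h1 : `|g1 n| <= eps / 2 * `|e n| by near: n; apply: g1e.
have h2 : `|g2 n| <= eps / 2 / (`|K| + 1) * `|e n| by near: n; apply: g2e.
apply: le_trans fle _; rewrite [eps]splitr mulrDl lerD //.
  exact: le_trans (ler_norm _) h1.
apply: le_trans (ler_norm _) _; rewrite normrM.
apply: (@le_trans _ _ ((`|K| + 1) * `|g2 n|)); first by rewrite ler_wpM2r // lerDl.
by rewrite -ler_pdivlMl // (le_trans h2) // mulrAC [leRHS]mulrC.
Unshelve. all: by end_near.
Qed.

(** The two sequences may decay with different exponents; the smaller one serves both. *)
Lemma polynomially_small_lincomb f g1 g2 (K : R) :
  (forall n, 0 <= f n <= g1 n + K * g2 n) ->
  polynomially_small g1 -> polynomially_small g2 -> polynomially_small f.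
Proof.
move=> f_le [d1 d10 g1o] [d2 d20 g2o].
have weaken d g : (minn d1 d2 <= d)%N -> g =o_\oo (fun n => (n%:R : R) ^- d) ->
    g =o_\oo (fun n => (n%:R : R) ^- (minn d1 d2)).
  move=> le_d /eqoP gd; apply/eqoP => eps eps0; near=> n.
  have n1 : (0 < n)%N by near: n; exists 1%N.
  apply: le_trans (_ : eps * `|n%:R ^- d| <= _); first by near: n; apply: gd.
  rewrite ler_wpM2l ?(ltW eps0) // !ger0_norm ?invr_ge0 ?exprn_ge0 //.
  by rewrite lef_pV2 ?posrE ?exprn_gt0 ?ltr0n // ler_weXn2l // ler1n.
exists (minn d1 d2); first by rewrite leq_min d10.
apply: littleo_le_lincomb f_le _ _; [apply: weaken g1o|apply: weaken g2o].
  exact: geq_minl.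
exact: geq_minr.
Unshelve. all: by end_near.
Qed.

Lemma exponentially_small_lincomb f g1 g2 (K : R) :
  (forall n, 0 <= f n <= g1 n + K * g2 n) ->
  exponentially_small g1 -> exponentially_small g2 -> exponentially_small f.
Proof.
move=> f_le [d1 d10 g1o] [d2 d20 g2o].
have weaken (d : R) g : Num.min d1 d2 <= d -> g =o_\oo (fun n => expR (- d * n%:R)) ->
    g =o_\oo (fun n => expR (- Num.min d1 d2 * n%:R)).
  move=> le_d /eqoP gd; apply/eqoP => eps eps0; near=> n.
  apply: le_trans (_ : eps * `|expR (- d * n%:R)| <= _); first by near: n; apply: gd.
  rewrite ler_wpM2l ?(ltW eps0) // !ger0_norm ?expR_ge0 //.
  by rewrite ler_expR ler_wpM2r // lerN2.
exists (Num.min d1 d2); first by rewrite lt_min d10.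
apply: littleo_le_lincomb f_le _ _; [apply: weaken g1o|apply: weaken g2o].
  by rewrite ge_min lexx.
by rewrite ge_min lexx orbT.
Unshelve. all: by end_near.
Qed.

End Smallness.

(** * The universal morphism out of a free group *)

Section FreeEvaluation.
Context (k : nat) (G : groupType) (x : 'I_k -> G).
Local Open Scope group_scope.
Implicit Types (l : letter 'I_k) (u v : seq (letter 'I_k)).

Definition letter_eval l : G := match l with inl i => x i | inr i => (x i)^-1 end.

(** Defined on all words, reduced or not, so that concatenation becomes product; invariance under
    [freduce] then makes it a morphism on the free group. *)
Definition word_eval u : G := foldr (fun l g => letter_eval l * g) 1 u.

Definition free_eval (w : fgroup 'I_k) : G := word_eval w.

Lemma letter_eval_linv l : letter_eval (linv l) = (letter_eval l)^-1.
Proof. by case: l => i //=; rewrite invgK. Qed.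

Lemma word_eval_cat u v : word_eval (u ++ v) = word_eval u * word_eval v.
Proof. by elim: u => [|l u IH] /=; rewrite ?mul1g // -mulgA -IH. Qed.

Lemma word_eval_freduce u : word_eval (freduce u) = word_eval u.
Proof.
elim: u => //= l u <-; case: (freduce u) => //= l' v.
by case: eqP => //= ->; rewrite letter_eval_linv mulVKg.
Qed.

Lemma free_evalM : {morph free_eval : v w / v * w}.
Proof. by move=> v w; rewrite /free_eval word_eval_freduce word_eval_cat. Qed.

HB.instance Definition _ := isMultiplicative.Build _ _ free_eval free_evalM.

Lemma free_evalV w : free_eval w^-1 = (free_eval w)^-1.
Proof. by apply: (mulIg (free_eval w)); rewrite -free_evalM !mulVg. Qed.

Lemma free_eval_gen i : free_eval (fg_gen i) = x i.
Proof. exact: mulg1. Qed.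

Lemma free_eval_image (X : set G) : X = range x ->
  free_eval @` setT = generated_subgroup X.
Proof.
move=> ->; apply/seteqP; split=> [_ [[u ru] _ <-]|].
  move=> K [[K1 KM KV] xK]; rewrite /free_eval /=.
  elim: u {ru} => //= l u; apply: KM.
  by case: l => i /=; [|apply: KV]; apply: xK; exists i.
apply: smallest_sub; last by move=> _ [i _ <-]; exists (fg_gen i); rewrite ?free_eval_gen.
split; first by exists 1.
  by move=> _ _ [v _ <-] [w _ <-]; exists (v * w); rewrite ?free_evalM.
by move=> _ [v _ <-]; exists v^-1; rewrite ?free_evalV.
Qed.

Lemma free_eval_inj : (forall w, free_eval w = 1 -> w = 1) -> injective free_eval.
Proof.
move=> ker1 v w vw; apply: (mulIg w^-1); rewrite mulgV; apply: ker1.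
by rewrite free_evalM free_evalV vw mulgV.
Qed.

End FreeEvaluation.

(** * Cancellation in products of reduced words *)

Section CentralTree.
Context (A : finType).
Implicit Types (u v : seq (letter A)) (w y z : fgroup A) (h : tuples (fgroup A)).

Lemma fgval_mul w y : fgval (w * y)%g = foldr (@fcons A) y w.
Proof. by rewrite /= freduce_cat (freduce_id (valP y)). Qed.

(** Induction from the right end of [u]: its last letter cancels exactly when [v] starts with the
    inverse letter, and then the common prefix of [linv_rev u] and [v] loses one letter too;
    otherwise the concatenation is already reduced. *)
Lemma prefix_foldr_fcons u v : reduced u -> reduced v ->
  prefix (take (size u - common_prefix_length (linv_rev u) v) u)
         (foldr (@fcons A) v u).
Proof.
elim/last_ind: u v => [v _ _|u a IH v rua rv]; first exact: prefix0s.
have ru : reduced u by move: rua; rewrite -cats1 => /reduced_cat/andP[].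
have [[v' [vE rv']]|nv] := pselect (exists v', v = linv a :: v' /\ reduced v').
  rewrite foldr_rcons vE /= eqxx /linv_rev map_rcons rev_rcons /= eqxx size_rcons subSS.
  by rewrite -cats1 takel_cat ?leq_subr //; apply: IH.
have -> : foldr (@fcons A) v (rcons u a) = rcons u a ++ v.
  rewrite -{1}(freduce_id rv) -freduce_cat freduce_id //.
  have ra : path (fun b c : letter A => c != linv b) a v.
    case: v rv nv => //= b v rv nv; rewrite rv andbT.
    apply/eqP => bE; apply: nv; exists v; rewrite bE; split=> //.
    exact: path_sorted rv.
  case: u rua {IH ru} => //= b u; rewrite /reduced /= cat_path last_rcons ra => ->.
  by [].
set n := (_ - _)%N; by rewrite -{2}(cat_take_drop n (rcons u a)) -catA prefix_prefix.
Qed.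

(** Only the first [p.+1] letters of [y] are known, and they agree with those of [z]. This caps the
    cancellation with [w] at [p] letters, and more than [p] letters of [w] survive. *)
Lemma take_mul p w y z : (2 * p < size w)%N -> (p < size z)%N ->
  take p.+1 y = take p.+1 z ->
  (common_prefix_length (fgval (w^-1)%g) (fgval z) <= p)%N ->
  take p.+1 (fgval (w * y)%g) = take p.+1 w.
Proof.
move=> pw pz yz wz; rewrite fgval_mul.
have := prefix_foldr_fcons (valP w) (valP y); set c := common_prefix_length _ _.
have cp : (c <= p)%N.
  rewrite leqNgt; apply: contraTN wz; rewrite -ltnNge /c.
  rewrite !leq_common_prefix_length => /and3P[-> _ /eqP ->] /=.
  by rewrite pz yz eqxx.
have cw : (p < size w - c)%N by lia.
by move=> /prefixP[t /= ->]; rewrite takel_cat ?take_takel ?size_takel ?leq_subr.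
Qed.

End CentralTree.

(** * The central tree property implies freeness *)

Section Basis.
Context (A : finType) (h : tuples (fgroup A)).
Hypothesis ctp : central_tree_property h.
Let k := @size (fgroup A) h.
Let x (i : 'I_k) : fgroup A := nth 1%g h i.
Implicit Types (l : letter 'I_k).

Let letter_index l : nat := match l with inl i => 2 * i | inr i => (2 * i).+1 end.

Let nth_letter_index l : nth 1%g (pm_tuple h) (letter_index l) = letter_eval x l.
Proof.
case: l => i; rewrite nth_pm_tuple /=.
  by rewrite mul2n odd_double doubleK.
by rewrite mul2n odd_double /= uphalf_double.
Qed.

Lemma size_letter_eval l : (2 * lcp h < size (letter_eval x l))%N.
Proof.
have size_x i : (2 * lcp h < size (x i))%N.
  apply: leq_trans ctp _; rewrite min_lengthE; apply: min_seq_le.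
  by apply/mapP; exists (x i); rewrite ?mem_nth.
by case: l => i //=; rewrite size_rev size_map.
Qed.

(** Distinct letters occupy distinct positions of [pm_tuple h], so the maximum defining [lcp] covers
    the pair. *)
Lemma common_prefix_letter_eval l l' : l != l' ->
  (common_prefix_length (fgval (letter_eval x l)) (fgval (letter_eval x l')) <= lcp h)%N.
Proof.
move=> ll'; rewrite -!nth_letter_index; apply: lcp_ge.
- by case: l {ll'} => i /=; have := ltn_ord i; rewrite /k; lia.
- by case: l' {ll'} => i /=; have := ltn_ord i; rewrite /k; lia.
- apply: contraNneq ll'; case: l => i; case: l' => j /= ij; try lia;
  by apply/eqP; congr (_ _); apply: val_inj => /=; lia.
Qed.

(* Each cancellation is shorter than half of either factor, so the beginning of
   the first factor survives in the whole product. *)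
Lemma take_word_eval l (u : seq (letter 'I_k)) : reduced (l :: u) ->
  take (lcp h).+1 (fgval (word_eval x (l :: u))) =
  take (lcp h).+1 (fgval (letter_eval x l)).
Proof.
elim: u l => [|l' u IH] l; first by rewrite [word_eval _ _]mulg1.
move=> /andP[ll' ru]; 
(* Here [p] is [lcp h], [z] the second factor and [y] the value of the whole remaining word;
   reducedness makes [l'] differ from [linv l]. *)
apply: take_mul (size_letter_eval l) _ (IH l' ru) _.
  by have := size_letter_eval l'; lia.
by rewrite -letter_eval_linv common_prefix_letter_eval // eq_sym.
Qed.

(** The kernel is trivial: the value of a nonempty reduced word keeps the first [(lcp h).+1] letters
    of its first factor, so it is not the empty word. *)
Lemma central_tree_basis : basis_of_generated_subgroup h.
Proof.
exists (free_eval x); first exact: free_eval_gen.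
have image : free_eval x @` setT = generated_subgroup [set w | w \in (h : seq _)].
  apply: free_eval_image; apply/seteqP; split=> [w /= /(nthP 1%g)[i ih <-]|_ [i _ <-]].
    by exists (Ordinal ih).
  exact: mem_nth.
split; first by move=> w _; case/seteqP: image => + _; apply; exists w.
  move=> v w _ _; apply: free_eval_inj => {v w} -[[|l u] ru] //= w1.
    exact: val_inj.
  have := take_word_eval ru; rewrite [word_eval _ _]w1 /= => /(congr1 size).
  by rewrite size_takel //; apply: leq_ltn_trans (size_letter_eval l); lia.
by case/seteqP: image.
Qed.

End Basis.

Theorem theorem3p18 (A : finType) (hA : (0 < #|A|)%N) (R : realType)
  (C alpha : R) (hC : 1 <= C) (halpha0 : 0 < alpha) (halpha1 : alpha < 1)
  (P : nat -> probability (tuples (fgroup A)) R)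
  (hP : prefix_heavy_tuples C alpha P)
  (eta : nat -> R) (heta : forall n, 0 < eta n)
  (tail0 : size_min_tail alpha P eta n @[n --> \oo] --> (0 : R))
  (eta0 : eta n @[n --> \oo] --> (0 : R)) :
  (generically P (@central_tree_property A) /\
   generically P (@basis_of_generated_subgroup A)) /\
  [/\ polynomially_small (size_min_tail alpha P eta) -> polynomially_small eta ->
        polynomially_generically P (@central_tree_property A),
      super_polynomially_small (size_min_tail alpha P eta) -> super_polynomially_small eta ->
        super_polynomially_generically P (@central_tree_property A) &
      exponentially_small (size_min_tail alpha P eta) -> exponentially_small eta ->
        exponentially_generically P (@central_tree_property A)].
Proof.
have [T [Rn [T0 hRn PE]]] := hP.
pose K := 4 * C / alpha.
have fail_le n : 0 <= failure_Pr P (@central_tree_property A) n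
                 <= size_min_tail alpha P eta n + K * eta n.
  rewrite Pr_ge0 /=.
  exact: (failure_Pr_le hC halpha0 halpha1 hRn T0 PE (ltW (heta n))).
have ctp0 : generically P (@central_tree_property A).
  apply: (@squeeze_cvgr _ _ _ _ (fun=> 0)
    (fun n => size_min_tail alpha P eta n + K * eta n)); last first.
  - rewrite -[0]addr0 -[X in _ + X](mulr0 K).
    by apply: cvgD => //; apply: cvgMr.
  - exact: cvg_cst.
  - by near=> n.
split; first split=> //.
  (* Failure to be a basis is contained in failure of the central tree property. *)
  apply: (@squeeze_cvgr _ _ _ _ (fun=> 0)
    (failure_Pr P (@central_tree_property A))) => //; last exact: cvg_cst.
  near=> n; rewrite Pr_ge0 /= le_Pr // => h nb.
  by apply: contra_not nb; apply: central_tree_basis.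
split.
- exact: polynomially_small_lincomb.
(* The exponent [d] is prescribed, so both hypotheses are taken at the same rate. *)
- by move=> tail_small eta_small d d0; apply: littleo_le_lincomb fail_le _ _; auto.
- exact: exponentially_small_lincomb.
Unshelve. all: by end_near.
Qed.
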